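(* Let $\mu$ be a probability distribution on $\mathbb{R}$ all of whose moments exist, with mean $0$ and second moment $1$. For each $N\in\mathbb{N}$ let $A_N$ be an $N\times N$ Wigner matrix corresponding to $\mu$. Then for all $m\in\mathbb{N}$, $$\lim_{N\to\infty}\mathbb{E}\left[\operatorname{tr}(A_N^m)\right]=\frac{1}{2\pi}\int_{-2}^{2}x^m\sqrt{4-x^2}\,dx .$$
   Context: $\operatorname{tr}=\frac1N\operatorname{Tr}$ is the normalized trace on $N\times N$ matrices. An $N\times N$ Wigner matrix corresponding to a probability distribution $\mu$ on $\mathbb{R}$ is a random matrix $A_N=\frac1{\sqrt N}(a_{ij})_{i,j=1}^N$ with real entries such that $a_{ij}=a_{ji}$ for all $i,j$, the family $\{a_{ij}\mid i\ge j\}$ is independent, and each $a_{ij}$ has distribution $\mu$. *)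

(* Defs.v *)
From HB Require Import structures.
From mathcomp Require Import all_boot all_order all_algebra finmap.
From mathcomp Require Import all_classical all_reals all_analysis.

Set Implicit Arguments.
Unset Strict Implicit.
Unset Printing Implicit Defensive.

Import Order.TTheory GRing.Theory Num.Theory.
Import numFieldNormedType.Exports.

Local Open Scope classical_set_scope.
Local Open Scope ring_scope.

Definition independent_RVs (d : measure_display) (T : measurableType d)
    (R : realType) (P : probability T R) (I : choiceType) (D : set I)
    (X : I -> {RV P >-> R}) : Prop :=
  forall J : {fset I}, [set` J] `<=` D ->
  forall B : I -> set R, (forall i, measurable (B i)) ->
    P (\bigcap_(i in [set` J]) (X i @^-1` B i)) =
    (\prod_(i <- J) P (X i @^-1` B i))%E.

Definition wigner (d : measure_display) (T : measurableType d) (R : realType)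
    (P : probability T R) (mu : probability R R) (N : nat)
    (A : T -> 'M[R]_N) : Prop :=
  exists a : 'I_N -> 'I_N -> {RV P >-> R},
    [/\ forall w : T, A w = (Num.sqrt N%:R)^-1 *: \matrix_(i, j) a i j w,
        forall i j (w : T), a i j w = a j i w,
        independent_RVs [set p : 'I_N * 'I_N | (p.2 <= p.1)%N]
          (fun p => a p.1 p.2)
      & forall i j (B : set R), measurable B -> distribution P (a i j) B = mu B].

Definition ntr (R : realType) (N : nat) (A : 'M[R]_N) : R := N%:R^-1 * \tr A.

(* Main.v *)
Require Import Defs.
From HB Require Import structures.
From mathcomp Require Import all_boot all_order all_algebra finmap.
From mathcomp Require Import all_classical all_reals all_analysis.
From mathcomp Require Import measurable_realfun.
From mathcomp Require Import zify ring.

Set Implicit Arguments.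
Unset Strict Implicit.
Unset Printing Implicit Defensive.

Import Order.TTheory GRing.Theory Num.Theory.
Import numFieldNormedType.Exports.

Local Open Scope classical_set_scope.
Local Open Scope ring_scope.

(** The proof is Wigner's method of moments.

    Expanding the trace, E[tr (A_N^m)] is N^(-1-m/2) times a sum over closed
    walks of length m in {0, ..., N-1}, the term of a walk being the expectation
    of the product of the entries it meets. By independence
    (expectation_prod_indep) this is the product, over undirected edges, of the
    moment of mu whose order is the number of times the edge is taken. As the
    mean is 0, only walks that take no edge exactly once contribute. Such a walk
    has at most m/2 edges, hence at most m/2 + 1 vertices, and when it has that
    many vertices its graph is a tree each of whose edges is taken twice
    (closed_walk_contour): the walk is the contour of the tree, and it
    contributes 1 because the variance is 1. The other walks have at most
    (m+1)/2 vertices, so there are O(N^((m+1)/2)) of them, each with a bounded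
    contribution, and they disappear in the limit (sum_weight_ncontour).

    Counting contours exactly, and comparing Catalan numbers with the moments of
    the semicircle law, is avoided by matching recurrences. The number of ways to
    complete a contour in l steps from depth h is governed by the next step: up to
    one of about N new vertices, or down to the parent. Divided by
    N^((l-h)/2), it satisfies in the limit D(l+1,h) = D(l,h+1) + D(l,h-1) with
    D(0,h) = [h = 0] and D(l,-1) = 0. The integrals of x^l U_h(x/2) against the
    semicircle law, with U_h the Chebyshev polynomials of the second kind, obey
    the same recurrence and initial values (sc_momentS, sc_moment0), so they are
    the limits (cvg_ncontour). The theorem is the case l = m, h = 0. *)

(** * Expectations of products of independent variables *)

Section density.
Context d (T : measurableType d) (R : realType).
Variables (P : {measure set T -> \bar R}) (nu : {measure set R -> \bar R}).
Variables (X : T -> R) (mX : measurable_fun setT X).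
Variables (G : T -> R) (mG : measurable_fun setT G) (G0 : forall x, 0 <= G x).

Import HBNNSimple.
Local Open Scope ereal_scope.

(** The two sides are integrals of f against the image under X of the measure
    with density G and against nu; the hypothesis says that these measures
    agree on measurable sets, hence they agree on simple functions, and on
    nonnegative functions by monotone convergence. This is what replaces an
    indicator by an arbitrary function, one variable at a time. *)
Lemma ge0_integral_density (f : R -> R) :
  (forall B, measurable B -> \int[P]_(x in X @^-1` B) (G x)%:E = nu B) ->
  measurable_fun setT f -> (forall y, (0 <= f y)%R) ->
  \int[P]_x (f (X x) * G x)%:E = \int[nu]_y (f y)%:E.
Proof.
move=> XG mf f0.
have mXB B : measurable B -> measurable (X @^-1` B).
  by move=> mB; rewrite -[_ @^-1` _]setTI; exact: mX.
have mfE : measurable_fun [set: R] (fun y => (f y)%:E) by exact/measurable_EFinP.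
pose h := nnsfun_approx measurableT mfE.
have cvgh y : EFin \o h^~ y @ \oo --> (f y)%:E.
  by apply: (cvg_nnsfun_approx measurableT mfE) => // z _; rewrite /= lee_fin.
have ndh y : nondecreasing_seq (h ^~ y).
  by move=> a b ab; exact/lefP/nd_nnsfun_approx.
have cvL : \int[P]_x (h n (X x) * G x)%:E @[n --> \oo] -->
    \int[P]_x (f (X x) * G x)%:E.
  have -> : \int[P]_x (f (X x) * G x)%:E =
      \int[P]_x (limn (fun n => (h n (X x) * G x)%:E)).
    apply: eq_integral => x _; apply/esym/cvg_lim => //.
    rewrite EFinM; under eq_fun do rewrite EFinM.
    by apply: cvgeZr => //; exact: cvgh.
  apply: cvg_monotone_convergence => //.
  - move=> n; apply/measurable_EFinP; apply: measurable_funM => //.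
    exact: measurableT_comp.
  - by move=> n x _; rewrite lee_fin mulr_ge0.
  - by move=> x _ a b ab; rewrite lee_fin ler_wpM2r //; exact: ndh.
have cvR : \int[nu]_y (h n y)%:E @[n --> \oo] --> \int[nu]_y (f y)%:E.
  have -> : \int[nu]_y (f y)%:E = \int[nu]_y (limn (fun n => (h n y)%:E)).
    by apply: eq_integral => x _; apply/esym/cvg_lim => //; exact: cvgh.
  apply: cvg_monotone_convergence => //.
  - by move=> n; exact/measurable_EFinP.
  - by move=> n x _; rewrite lee_fin.
  - by move=> x _ a b ab; rewrite lee_fin; exact: ndh.
have key n : \int[P]_x (h n (X x) * G x)%:E = \int[nu]_y (h n y)%:E.
  have mh r : measurable (h n @^-1` [set r]) by exact: measurable_sfunP.
  transitivity (\sum_(k \in range (h n))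
      \int[P]_x ((k * \1_(h n @^-1` [set k]) (X x)) * G x)%:E).
    transitivity (\int[P]_x (\sum_(k \in range (h n))
        (k * \1_(h n @^-1` [set k]) (X x))%:E * (G x)%:E)).
      apply: eq_integral => x _.
      rewrite -ge0_mule_fsuml; last by move=> y; exact: nnfun_muleindic_ge0.
      by rewrite fsumEFin // -(fimfunE _ (X x)) -EFinM.
    rewrite ge0_integral_fsum//.
    - move=> k; apply: emeasurable_funM; last exact/measurable_EFinP.
      apply/measurable_EFinP; apply: measurable_funM => //.
      by apply: measurableT_comp => //.
    - move=> k x _; rewrite EFinM mule_ge0 ?lee_fin//.
      exact: (nnfun_muleindic_ge0 (h n) k (X x)).
  transitivity (\sum_(k \in range (h n))
      \int[nu]_y (k * \1_(h n @^-1` [set k]) y)%:E); last first.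
    rewrite -ge0_integral_fsum//.
    - by apply: eq_integral => t tE; rewrite /= fimfunE -fsumEFin.
    - by move=> k; apply/measurable_EFinP; exact: measurable_funM.
    - by move=> k y _; exact: nnfun_muleindic_ge0.
  apply: eq_fsbigr => k /set_mem [y0 _ <-].
  set k' := h n y0; have k0 : (0 <= k')%R by exact: fun_ge0.
  under eq_integral do rewrite -mulrA EFinM.
  under [RHS]eq_integral do rewrite EFinM.
  rewrite ge0_integralZl ?lee_fin//; last 2 first.
  - apply/measurable_EFinP; apply: measurable_funM => //.
    exact: measurableT_comp.
  - by move=> x _; rewrite lee_fin mulr_ge0.
  rewrite ge0_integralZl ?lee_fin//; last 1 first.
  - exact/measurable_EFinP.
  congr (_ * _).
  rewrite integral_indic// setIT -XG//.
  rewrite [RHS]integral_mkcond; apply: eq_integral => x _.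
  rewrite patchE indicE.
  have -> : (x \in X @^-1` (h n @^-1` [set k'])) = (X x \in h n @^-1` [set k']).
    by apply/idP/idP => /set_mem ?; exact/mem_set.
  by case: ifP; rewrite ?mul1r ?mul0r.
move: cvL; under eq_fun do rewrite key.
by move=> cvL; exact: (cvg_unique _ cvL cvR).
Qed.

End density.

Section independence.
Context d (T : measurableType d) (R : realType).
Variables (P : probability T R) (mu : probability R R).
Variables (I : choiceType) (D : set I) (X : I -> {RV P >-> R}).
Hypothesis indX : independent_RVs D X.
Hypothesis lawX :
  forall i (B : set R), measurable B -> distribution P (X i) B = mu B.

Definition upd (U : Type) (g : I -> U) (q : I) (h : U) (p : I) : U :=
  if p == q then h else g p.

Lemma integrable_measurable_fun (f : R -> R) :
  mu.-integrable setT (EFin \o f) -> measurable_fun setT f.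
Proof. by move=> /measurable_int/measurable_EFinP. Qed.

Lemma measurable_prod_RV (s : seq I) (g : I -> R -> R) :
  (forall p, measurable_fun setT (g p)) ->
  measurable_fun setT (fun w => \prod_(p <- s) g p (X p w)).
Proof.
move=> mg; apply: measurable_prod => p _.
by apply: measurableT_comp.
Qed.

(** For indicators the product rule is the definition of independence: the
    product of the indicators is the indicator of the intersection. *)
Lemma integral_prod_indic (s : seq I) (B : I -> set R) :
  uniq s -> (forall p, p \in s -> D p) -> (forall p, measurable (B p)) ->
  (\int[P]_w (\prod_(p <- s) (\1_(B p) (X p w) : R))%:E =
   (\prod_(p <- s) \int[mu]_y (\1_(B p) y : R))%:E)%E.
Proof.
move=> us sD mB.
pose J : {fset I} := [fset p in s]%fset.
have JE : perm_eq J s.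
  by apply: uniq_perm => // p; rewrite !inE.
have JD : [set` J] `<=` D.
  by move=> p /=; rewrite !inE; exact: sD.
have := indX JD mB; rewrite (perm_big _ JE) /=.
set E := \bigcap_(i in _) _ => PE.
have mE : measurable E.
  apply: fin_bigcap_measurable => [|p _]; first exact: finite_fset.
  by rewrite -[_ @^-1` _]setTI; exact: measurable_funP.
transitivity (P E).
  rewrite -[E in RHS]setIT -integral_indic//.
  apply: eq_integral => w _; congr EFin; rewrite indicE.
  have [wE|wE] := boolP (w \in E).
    rewrite big_seq big1 // => p ps; rewrite indicE mem_set//.
    by move: wE => /set_mem; apply => /=; rewrite !inE.
  have : ~ E w by move=> /mem_set; rewrite (negbTE wE).
  move=> /existsNP[p /not_implyP[/=]]; rewrite !inE => ps Bp.
  rewrite (bigD1_seq p) //= indicE memNset ?mul0r//.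
rewrite PE -prodEFin; apply: eq_bigr => p _.
rewrite /Rintegral integral_indic// setIT fineK; first exact: lawX.
exact: fin_num_measure.
Qed.

Lemma prod_upd (A : Type) (s : seq I) (q : I) (h : A) (g : I -> A)
    (F : I -> A -> R) : q \notin s ->
  \prod_(p <- q :: s) F p (upd g q h p) = F q h * \prod_(p <- s) F p (g p).
Proof.
move=> qs; rewrite big_cons {1}/upd eqxx; congr (_ * _).
rewrite big_seq [RHS]big_seq; apply: eq_bigr => p ps.
by rewrite /upd; case: eqVneq => // pq; move: qs; rewrite -pq ps.
Qed.

(** The factors indexed by s2 are indicators, those indexed by s1 are arbitrary.
    A variable q moves from s2 to s1 as follows: by induction the rule holds for
    every indicator in place of g q, which says that X q has law a multiple of
    mu under the measure whose density is the product of the other factors. *)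
Lemma integral_prod_ge0 (s1 s2 : seq I) (g : I -> R -> R) (B : I -> set R) :
  uniq (s1 ++ s2) -> (forall p, p \in s1 ++ s2 -> D p) ->
  (forall p, measurable (B p)) ->
  (forall p, mu.-integrable setT (EFin \o g p)) ->
  (forall p y, 0 <= g p y) ->
  (forall p, p \in s2 -> g p = \1_(B p)) ->
  (\int[P]_w (\prod_(p <- s1 ++ s2) g p (X p w))%:E =
   (\prod_(p <- s1 ++ s2) \int[mu]_y g p y)%:E)%E.
Proof.
elim: s1 s2 g B => [|q s1 IH] s2 g B.
  move=> us sD mB ig g0 gB; rewrite !cat0s in us sD *.
  rewrite [in RHS]big_seq (eq_bigr (fun p => \int[mu]_y (\1_(B p) y : R))); last first.
    by move=> p ps; rewrite (gB p ps).
  rewrite -[in RHS]big_seq -integral_prod_indic//.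
  apply: eq_integral => w _; congr EFin.
  by rewrite big_seq [RHS]big_seq; apply: eq_bigr => p /gB ->.
move=> us sD mB ig g0 gB.
set s := s1 ++ s2.
have us' : q \notin s /\ uniq s by move: us; rewrite cat_cons /= => /andP.
case: us' => qs us'.
have pe : perm_eq (s1 ++ q :: s2) (q :: s) by rewrite -cat1s perm_catCA.
pose G w := \prod_(p <- s) g p (X p w).
pose c := \prod_(p <- s) \int[mu]_y g p y.
have c0 : 0 <= c by apply: prodr_ge0 => p _; apply: Rintegral_ge0.
have mg p : measurable_fun setT (g p) by exact: integrable_measurable_fun.
(* The constant c has to be a nonnegative real for mscale; it is finite because
   all factors are integrable. *)
have H C : measurable C ->
    (\int[P]_(x in X q @^-1` C) (G x)%:E = mscale (NngNum c0) mu C)%E.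
  move=> mC.
  have := IH (q :: s2) (upd g q \1_C) (upd B q C).
  rewrite (perm_big _ pe) (prod_upd _ _ (fun _ h => \int[mu]_y h y)) //.
  under eq_integral => w _.
    rewrite (perm_big _ pe) (prod_upd _ _ (fun p h => h (X p w))) //; over.
  move=> IH'; rewrite /mscale /=.
  have -> : (c%:E * mu C = (\int[mu]_y \1_C y * c)%:E)%E.
    rewrite muleC EFinM; congr (_ * _)%E.
    by rewrite /Rintegral integral_indic// setIT fineK//; exact: fin_num_measure.
  rewrite -IH'.
  - rewrite [LHS]integral_mkcond; apply: eq_integral => x _.
    rewrite patchE indicE.
    have -> : (x \in X q @^-1` C) = (X q x \in C).
      by apply/idP/idP => /set_mem ?; exact/mem_set.
    by case: ifP; rewrite ?mul1r ?mul0r.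
  - by rewrite (perm_uniq pe) /= qs.
  - by move=> p; rewrite (perm_mem pe) => ps; apply: sD; rewrite cat_cons.
  - by move=> p; rewrite /upd; case: eqP.
  - move=> p; rewrite /upd; case: eqP => // _.
    exact: integrable_indic.
  - by move=> p y; rewrite /upd; case: eqP => // _.
  - move=> p; rewrite inE /upd; case: eqP => //= _; exact: gB.
rewrite cat_cons big_cons -/s -/c.
under eq_integral do rewrite big_cons -/s -/(G _).
rewrite (ge0_integral_density _ _ _ H) //.
- rewrite ge0_integral_mscale//=; last 2 first.
  + exact/measurable_EFinP.
  + by move=> y _; rewrite lee_fin.
  rewrite EFinM muleC /Rintegral fineK//.
  exact: (integrable_fin_num measurableT (ig q)).
- by rewrite /G; apply: measurable_prod_RV.
- by move=> w; apply: prodr_ge0.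
Qed.

(** Same scheme as for nonnegative factors: the factors indexed by s2 are
    nonnegative, and a signed factor g q is the difference of its positive and
    negative parts, to each of which the induction hypothesis applies. *)
Lemma integral_prod (s1 s2 : seq I) (g : I -> R -> R) :
  uniq (s1 ++ s2) -> (forall p, p \in s1 ++ s2 -> D p) ->
  (forall p, mu.-integrable setT (EFin \o g p)) ->
  (forall p, p \in s2 -> forall y, 0 <= g p y) ->
  P.-integrable setT (fun w => (\prod_(p <- s1 ++ s2) g p (X p w))%:E) /\
  (\int[P]_w (\prod_(p <- s1 ++ s2) g p (X p w))%:E =
   (\prod_(p <- s1 ++ s2) \int[mu]_y g p y)%:E)%E.
Proof.
elim: s1 s2 g => [|q s1 IH] s2 g us sD ig g0.
  rewrite !cat0s in us sD *.
  have mg p : measurable_fun setT (g p) by exact: integrable_measurable_fun.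
  have E : (\int[P]_w (\prod_(p <- s2) g p (X p w))%:E =
      (\prod_(p <- s2) \int[mu]_y g p y)%:E)%E.
    pose g' p y := `|g p y|.
    have gg' p : p \in s2 -> g p = g' p.
      by move=> ps; apply/funext => y; rewrite /g' ger0_norm// g0.
    have := @integral_prod_ge0 s2 [::] g' (fun=> set0).
    rewrite !cats0 => H.
    rewrite [in RHS]big_seq (eq_bigr (fun p => \int[mu]_y g' p y)); last first.
      by move=> p ps; rewrite gg'.
    rewrite -[in RHS]big_seq -H//.
    + apply: eq_integral => w _; congr EFin.
      by rewrite big_seq [RHS]big_seq; apply: eq_bigr => p /gg' ->.
    + by move=> p; exact: (integrable_norm (ig p)).
    + by move=> p y; exact: normr_ge0.
  split => //; apply/integrableP; split.
    by apply/measurable_EFinP; exact: measurable_prod_RV.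
  under eq_integral => w _.
    rewrite gee0_abs; last first.
      rewrite lee_fin big_seq; apply: prodr_ge0 => p ps; exact: g0.
    over.
  by rewrite E ltry.
set s := s1 ++ s2.
have us' : q \notin s /\ uniq s by move: us; rewrite cat_cons /= => /andP.
case: us' => qs us'.
have pe : perm_eq (s1 ++ q :: s2) (q :: s) by rewrite -cat1s perm_catCA.
have H h : mu.-integrable setT (EFin \o h) -> (forall y, 0 <= h y) ->
    P.-integrable setT
      (fun w => (h (X q w) * \prod_(p <- s) g p (X p w))%:E) /\
    (\int[P]_w (h (X q w) * \prod_(p <- s) g p (X p w))%:E =
     (\int[mu]_y h y * \prod_(p <- s) \int[mu]_y g p y)%:E)%E.
  move=> ih h0; have := IH (q :: s2) (upd g q h).
  rewrite (perm_big _ pe) (prod_upd _ _ (fun _ h => \int[mu]_y h y)) //.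
  have -> : (fun w => (\prod_(p <- s1 ++ q :: s2) upd g q h p (X p w))%:E) =
      (fun w => (h (X q w) * \prod_(p <- s) g p (X p w))%:E).
    apply/funext => w; congr EFin.
    by rewrite (perm_big _ pe) (prod_upd _ _ (fun p h => h (X p w))).
  apply.
  - by rewrite (perm_uniq pe) /= qs.
  - by move=> p; rewrite (perm_mem pe) => ps; apply: sD; rewrite cat_cons.
  - by move=> p; rewrite /upd; case: eqP.
  - by move=> p; rewrite inE /upd; case: eqP => //= _; exact: g0.
have ip : mu.-integrable setT (EFin \o (g q)^\+).
  exact: integrable_funrpos.
have im : mu.-integrable setT (EFin \o (g q)^\-).
  exact: integrable_funrneg.
have [Ip Ep] := H _ ip (funrpos_ge0 _).
have [Im Em] := H _ im (funrneg_ge0 _).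
have gE y : g q y = (g q)^\+ y - (g q)^\- y.
  by rewrite -[in LHS](funrposBneg (g q)).
have FE : (fun w => (\prod_(p <- (q :: s1) ++ s2) g p (X p w))%:E) =
   (fun w => (((g q)^\+ (X q w) * \prod_(p <- s) g p (X p w))%:E -
             ((g q)^\- (X q w) * \prod_(p <- s) g p (X p w))%:E)%E).
  by apply/funext => w; rewrite cat_cons big_cons -EFinB -mulrBl -gE.
split.
  by rewrite FE; apply: integrableB.
rewrite FE integralB// Ep Em -EFinB -mulrBl cat_cons big_cons -/s.
congr (_ * _)%:E.
rewrite -RintegralB//.
by apply: eq_Rintegral => y _; rewrite -gE.
Qed.

Lemma expectation_prod_indep (s : seq I) (g : I -> R -> R) :
  uniq s -> (forall p, p \in s -> D p) ->
  (forall p, mu.-integrable setT (EFin \o g p)) ->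
  P.-integrable setT (fun w => (\prod_(p <- s) g p (X p w))%:E) /\
  (\int[P]_w (\prod_(p <- s) g p (X p w))%:E =
   (\prod_(p <- s) \int[mu]_y g p y)%:E)%E.
Proof. by move=> us sD ig; have := @integral_prod s [::] g; rewrite !cats0; apply. Qed.

End independence.

(** * Moments of the semicircle law *)

Section semicircle.
Context (R : realType).
Local Notation leb := (@lebesgue_measure R).
Implicit Types (f F : R -> R) (l h n : nat).

Lemma is_derive_continuous F (f : R -> R) :
  (forall x, is_derive x (1 : R) F (f x)) -> continuous F.
Proof.
move=> dF x; apply: differentiable_continuous.
by apply/derivable1_diffP; case: (dF x).
Qed.

Lemma derivable_oo_LRcontinuousT F f a b :
  (forall x, is_derive x (1 : R) F (f x)) -> derivable_oo_LRcontinuous F a b.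
Proof.
move=> dF; have cF := is_derive_continuous dF; split.
- by move=> x _; case: (dF x).
- by apply: cvg_at_right_filter; exact: cF.
- by apply: cvg_at_left_filter; exact: cF.
Qed.

Lemma Rintegral_antiderivative F f (a b : R) : a < b ->
  (forall x, is_derive x (1 : R) F (f x)) -> continuous f ->
  \int[leb]_(x in `[a, b]) f x = F b - F a.
Proof.
move=> ab dF cf; rewrite /Rintegral (@continuous_FTC2 _ f F)//.
- exact: continuous_subspaceT.
- exact: derivable_oo_LRcontinuousT.
- by move=> x _; rewrite derive1E; case: (dF x).
Qed.

Lemma continuous_integrable f (a b : R) : continuous f ->
  leb.-integrable `[a, b] (EFin \o f).
Proof.
move=> cf; apply: continuous_compact_integrable; first exact: segment_compact.
exact: continuous_subspaceT.
Qed.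

Lemma sin_natpi n : sin (n%:R * pi : R) = 0.
Proof.
elim: n => [|n IH]; first by rewrite mul0r sin0.
by rewrite -natr1 mulrDl mul1r sinDpi IH oppr0.
Qed.

Lemma continuous_cosM (c : R) : continuous (fun t : R => cos (c * t)).
Proof.
move=> x; apply: (@continuous_comp _ _ _ ( *%R c) cos).
  exact: mulrl_continuous.
exact: continuous_cos.
Qed.

Lemma continuous_sinM (c : R) : continuous (fun t : R => sin (c * t)).
Proof.
move=> x; apply: (@continuous_comp _ _ _ ( *%R c) sin).
  exact: mulrl_continuous.
exact: continuous_sin.
Qed.

Lemma Rintegral_cos_nat n :
  \int[leb]_(t in `[0, pi]) cos (n%:R * t) = if n == 0%N then pi else 0.
Proof.
case: n => [|n] /=.
  have dF (x : R) : is_derive x (1 : R) (id : R -> R) (cos (0 * x)).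
    by rewrite mul0r cos0; exact: is_derive_id.
  rewrite (Rintegral_antiderivative (pi_gt0 R) dF) ?subr0//.
  exact: continuous_cosM.
have dF (x : R) : is_derive x (1 : R)
    (n.+1%:R^-1 \*: (sin \o (n.+1%:R \*: (id : R -> R))))
    (cos (n.+1%:R * x)).
  apply: is_derive_eq.
  by rewrite /= /GRing.scale /= mulr1 mulrCA mulVf ?mulr1// pnatr_eq0.
rewrite (Rintegral_antiderivative (pi_gt0 R) dF); last exact: continuous_cosM.
by rewrite /= /GRing.scale /= sin_natpi !mulr0 sin0 !mulr0 subrr.
Qed.

Lemma natS_mul n (t : R) : n.+2%:R * t = n.+1%:R * t + t.
Proof. by rewrite -[n.+2%:R]natr1 mulrDl mul1r. Qed.

Lemma natP_mul n (t : R) : n%:R * t = n.+1%:R * t - t.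
Proof. by rewrite -[n.+1%:R]natr1 mulrDl mul1r addrK. Qed.

(** After the substitution x = 2 cos t this is the integral over [-2, 2] of
    x^l U_h(x/2) sqrt(4 - x^2), where U_h is the Chebyshev polynomial of the
    second kind, since sin ((h+1) t) = sin t * U_h(cos t). *)
Definition sc_moment l h : R :=
  \int[leb]_(t in `[0, pi])
    ((2 * cos t) ^+ l * (4 * sin (h.+1%:R * t) * sin t)).

Lemma continuous_sc l h : continuous (fun t : R =>
  (2 * cos t) ^+ l * (4 * sin (h.+1%:R * t) * sin t)).
Proof.
move=> x; apply: cvgM.
  apply: (@continuous_comp _ _ _ (fun t : R => 2 * cos t) (fun y => y ^+ l));
    last exact: exprn_continuous.
  by apply: cvgM; [exact: cvg_cst|exact: continuous_cos].
apply: cvgM; last exact: continuous_sin.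
by apply: cvgM; [exact: cvg_cst|exact: continuous_sinM].
Qed.

(** Orthogonality of U_h and U_0: the integrand is a difference of cosines. *)
Lemma sc_moment0 h : sc_moment 0 h = if h == 0%N then 2 * pi else 0.
Proof.
rewrite /sc_moment.
transitivity (\int[leb]_(t in `[0, pi])
    (2 * cos (h%:R * t) - 2 * cos (h.+2%:R * t))).
  apply: eq_Rintegral => t _; rewrite expr0 mul1r.
  rewrite (natS_mul h t) (natP_mul h t) !cosD cosN sinN; ring.
have ic n : leb.-integrable `[0, pi] (EFin \o (fun t => 2 * cos (n%:R * t))).
  apply: continuous_integrable => x.
  by apply: cvgM; [exact: cvg_cst|exact: continuous_cosM].
have ic' n : leb.-integrable `[0, pi] (EFin \o (fun t => cos (n%:R * t))).
  by apply: continuous_integrable; exact: continuous_cosM.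
rewrite RintegralB// !RintegralZl// !Rintegral_cos_nat /=.
by rewrite mulr0 subr0; case: ifP => // _; rewrite mulr0.
Qed.

(** The three-term recurrence x U_h(x/2) = U_(h+1)(x/2) + U_(h-1)(x/2), with
    U_(-1) = 0; it is also the recurrence for the number of nonnegative paths of
    length l from height h to 0, classified by their first step. *)
Lemma sc_momentS l h : sc_moment l.+1 h =
  sc_moment l h.+1 + if h is h'.+1 then sc_moment l h' else 0.
Proof.
have -> : (if h is h'.+1 then sc_moment l h' else 0) =
    \int[leb]_(t in `[0, pi])
      ((2 * cos t) ^+ l * (4 * sin (h%:R * t) * sin t)).
  case: h => // ; rewrite (_ : (fun t => _) = cst 0) ?Rintegral_cst ?mul0r//.
  by apply/funext => t; rewrite mul0r sin0 /=; ring.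
have ih : leb.-integrable `[0, pi]
    (EFin \o fun t => (2 * cos t) ^+ l * (4 * sin (h%:R * t) * sin t)).
  apply: continuous_integrable; case: h => [|h]; last exact: continuous_sc.
  rewrite (_ : (fun t => _) = cst 0); first exact: cst_continuous.
  by apply/funext => t; rewrite mul0r sin0 /=; ring.
have ih' : leb.-integrable `[0, pi]
    (EFin \o fun t => (2 * cos t) ^+ l * (4 * sin (h.+2%:R * t) * sin t)).
  exact/continuous_integrable/continuous_sc.
rewrite /sc_moment -RintegralD//.
apply: eq_Rintegral => t _.
by rewrite (natS_mul h t) (natP_mul h t) !sinD cosN sinN exprS; ring.
Qed.

Lemma integral_semicircle m :
  \int[leb]_(x in `[-2, 2]) (x ^+ m * Num.sqrt (4 - x ^+ 2)) = sc_moment m 0.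
Proof.
pose G (x : R) := x ^+ m * Num.sqrt (4 - x ^+ 2).
have cG : continuous G.
  move=> x; apply: cvgM; first exact: exprn_continuous.
  apply: (@continuous_comp _ _ _ (fun x : R => 4 - x ^+ 2)); last exact: sqrt_continuous.
  by apply: cvgB; [exact: cvg_cst|exact: exprn_continuous].
pose F (t : R) := 2 * cos t.
have dF (t : R) : is_derive t (1 : R) F (- (2 * sin t)).
  by rewrite -mulrN; exact: (@is_deriveZ _ _ _ (cos : R -> R)).
have dFE : derive1 F = (fun t => - (2 * sin t)).
  by apply/funext => t; rewrite derive1E; case: (dF t).
have cdF : continuous (derive1 F).
  rewrite dFE => x; apply: cvgN.
  by apply: cvgM; [exact: cvg_cst|exact: continuous_sin].
have := @integration_by_substitution_decreasing R F G 0 pi (ltW (pi_gt0 R)).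
rewrite /F cos0 cospi mulr1 mulrN1 -/F => H.
rewrite /sc_moment /Rintegral -/G H.
- congr fine; apply: eq_integral => t; rewrite inE /= in_itv /= => tpi.
  congr EFin; rewrite !fctE dFE /F /G.
  (* On [0, pi] the square root is 2 sin t without sign. *)
  have s0 : 0 <= sin t by exact: sin_ge0_pi.
  have -> : 4 - (2 * cos t) ^+ 2 = (2 * sin t) ^+ 2.
    by rewrite exprMn [RHS]exprMn sin2cos2; ring.
  by rewrite sqrtr_sqr ger0_norm ?mulr_ge0// mul1r; ring.
- by move=> x y xp yp xy; rewrite ltr_pM2l// ltr_cos.
- by move=> x _; exact: cdF.
- by apply: cvgP; apply: cvg_at_right_filter; exact: cdF.
- by apply: cvgP; apply: cvg_at_left_filter; exact: cdF.
- exact: derivable_oo_LRcontinuousT dF.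
- exact: continuous_subspaceT.
Qed.

End semicircle.

(** * Closed walks and trees *)

Lemma sum_count_mem (T : finType) (s : seq T) :
  (\sum_e count_mem e s = size s)%N.
Proof.
elim: s => [|x s IH] /=; first by rewrite big1.
rewrite big_split /= IH (bigD1 x)//= eqxx big1 ?addn0// => i /negbTE.
by rewrite eq_sym => ->.
Qed.

Section walks.
Local Close Scope classical_set_scope.
Variable N : nat.
Local Notation V := 'I_N.
Implicit Types (x y z : V) (w anc : seq V) (vis : {set V}) (e : V * V).

(** The undirected edge of x and y, represented by the index of the entry of a
    symmetric matrix that lies on or below the diagonal. *)
Definition epair x y : V * V := if (y <= x)%N then (x, y) else (y, x).

Definition edges x w : seq (V * V) := pairmap epair x w.

Definition inside vis e := (e.1 \in vis) && (e.2 \in vis).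

Lemma epair_sym x y : epair x y = epair y x.
Proof.
rewrite /epair; case: ltngtP => // /val_inj -> //.
Qed.

Lemma epair_inj x y z : epair x y = epair x z -> y = z.
Proof.
rewrite /epair; case: ifP => yx; case: ifP => zx [] // e1 e2.
- by rewrite -e2 -e1 in zx *.
- by rewrite e1 e2.
Qed.

Lemma inside_epair vis x y : inside vis (epair x y) = (x \in vis) && (y \in vis).
Proof. by rewrite /inside /epair; case: ifP => _ //=; rewrite andbC. Qed.

Lemma inside_edges vis x w : x \in vis -> {subset w <= vis} ->
  forall e, e \in edges x w -> inside vis e.
Proof.
elim: w x => [|y w IH] x xv wv e //=.
rewrite inE => /orP[/eqP->|].
  by rewrite inside_epair xv wv ?mem_head.
by apply: IH; [apply: wv; exact: mem_head|move=> z zw; apply: wv; rewrite inE zw orbT].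
Qed.

(** The contour (depth-first traversal) of a growing tree: x is the current
    vertex, anc the list of its ancestors, nearest first, and vis the set of
    vertices seen so far. Each step either discovers a new vertex, which becomes
    a child of x, or goes back to the parent of x; the walk ends at the root. *)
Fixpoint contour vis x anc w : bool :=
  if w is y :: w' then
    if y \notin vis then contour (y |: vis) y (x :: anc) w'
    else if anc is z :: anc' then (y == z) && contour vis z anc' w' else false
  else anc == [::].

Lemma contour_last vis x anc w : contour vis x anc w -> last x w = last x anc.
Proof.
elim: w vis x anc => [|y w IH] vis x anc /=; first by move/eqP->.
case: ifP => _; first by move/IH => ->.
by case: anc => // z anc /andP[/eqP-> /IH].
Qed.

(** Each edge from x up to the root is still to be walked once, other edges
    between seen vertices never again, and an edge discovered later is
    walked once in each direction. For a walk that starts at its root all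
    multiplicities are therefore 0 or 2. *)
Lemma contour_counts vis x anc w : {subset x :: anc <= vis} ->
  contour vis x anc w ->
  (forall e, inside vis e -> count_mem e (edges x w) = count_mem e (edges x anc))
  /\ (forall e, ~~ inside vis e -> count_mem e (edges x w) \in [:: 0; 2])%N.
Proof.
elim: w vis x anc => [|y w IH] vis x anc sv /=; first by move/eqP->.
have xv : x \in vis by apply: sv; exact: mem_head.
case: ifPn => [yv gw|yv].
  have sv' : {subset [:: y, x & anc] <= y |: vis}.
    move=> z; rewrite inE => /orP[/eqP->|/sv zv]; first exact: setU11.
    by rewrite inE zv orbT.
  have [IH1 IH2] := IH _ _ _ sv' gw.
  have sub e : inside vis e -> inside (y |: vis) e.
    by rewrite /inside !inE => /andP[-> ->]; rewrite !orbT.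
  have e0 e : inside vis e -> epair x y == e = false.
    by move=> ev; apply/eqP => e0; move: ev; rewrite -e0 inside_epair (negbTE yv) andbF.
  split=> e ev.
    by rewrite e0// IH1 /= ?(epair_sym y) ?e0// sub.
  have [ev'|ev'] := boolP (inside (y |: vis) e).
    rewrite IH1//= (epair_sym y).
    have -> : count_mem e (edges x anc) = 0%N.
      apply/count_memPn; apply: contra ev; apply: inside_edges => // z za.
      by apply: sv; rewrite inE za orbT.
    by case: eqP.
  have [eE|_] := eqVneq (epair x y) e; last by rewrite add0n; exact: IH2.
  by move: ev'; rewrite -eE inside_epair !inE xv eqxx orbT.
case: anc sv => // z anc sv /andP[/eqP yz gw]; rewrite {y}yz in yv *.
have sv' : {subset z :: anc <= vis}.
  by move=> t ta; apply: sv; rewrite inE ta orbT.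
have [IH1 IH2] := IH _ _ _ sv' gw.
split=> e ev; first by rewrite IH1.
have [eE|_] := eqVneq (epair x z) e; last by rewrite add0n; exact: IH2.
have zv : z \in vis by apply: sv'; exact: mem_head.
by move: ev; rewrite -eE inside_epair xv zv.
Qed.

(** An edge that is not yet in E can only be taken to a vertex not yet in vis,
    so that the walk closes no cycle and its graph is a tree. *)
Fixpoint treelike vis (E : {set V * V}) x w : bool :=
  if w is y :: w' then
    ((epair x y \in E) || (y \notin vis)) &&
    treelike (y |: vis) (epair x y |: E) y w'
  else true.

(** A new vertex is always reached through a new edge, so the walk has at most as
    many new vertices as new edges; equality fails as soon as a new edge leads
    to an old vertex. *)
Lemma vertices_le_edges vis (E : {set V * V}) x w : x \in vis ->
  {in E, forall e, inside vis e} ->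
  (#|vis :|: [set y in w]| + #|E| <=
   #|vis| + #|E :|: [set e in edges x w]| ?= iff treelike vis E x w)%N.
Proof.
elim: w vis E x => [|y w IH] vis E x xv Ev /=.
  have -> : vis :|: [set y in [::]] = vis.
    by apply/setP => z; rewrite !inE orbF.
  have -> : E :|: [set e in [::]] = E.
    by apply/setP => z; rewrite !inE orbF.
  by split; [exact: leqnn | exact: eqxx].
have yv' : y \in y |: vis by exact: setU11.
have Ev' : {in epair x y |: E, forall e, inside (y |: vis) e}.
  move=> e; rewrite inE => /orP[|/Ev].
    by rewrite inE => /eqP->; rewrite inside_epair !inE xv eqxx orbT.
  by rewrite /inside !inE => /andP[-> ->]; rewrite !orbT.
have := IH _ _ _ yv' Ev'.
have -> : (y |: vis) :|: [set z in w] = vis :|: [set z in y :: w].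
  by apply/setP => z; rewrite !inE; case: (z == y) (z \in vis) => [] [].
have -> : (epair x y |: E) :|: [set e in edges y w] =
    E :|: [set e in epair x y :: edges y w].
  by apply/setP => z; rewrite !inE; case: (z == _) (z \in E) => [] [].
rewrite !cardsU1.
have : (y \notin vis) ==> (epair x y \notin E).
  apply/implyP => yv; apply: contra yv => /Ev; rewrite inside_epair.
  by case/andP.
case: (y \in vis); case: (epair x y \in E) => //= _.
- rewrite add0n add1n => H.
  have {}H := H.1; split; first by apply: leq_trans H; rewrite addnS.
  by apply/eqP => E1; move: H; rewrite addnS E1 ltnn.
- rewrite !add1n addnS addSn => -[H1 H2].
  by split; [rewrite -ltnS | rewrite -H2 eqSS].
Qed.

(** Q is the list of edges walked so far; those off the path from x to the root
    have been walked twice already. If no edge is walked more than twice, then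
    from x an old vertex can only be reached along an edge of that path, and the
    only such edge at x leads to the parent. *)
Lemma treelike_contour vis x anc w (Q : seq (V * V)) :
  uniq (x :: anc) -> {subset x :: anc <= vis} ->
  {in Q, forall e, inside vis e} ->
  {in Q, forall e, e \in edges x anc \/ (2 <= count_mem e Q)%N} ->
  treelike vis [set e in Q] x w ->
  (forall e, count_mem e (edges x w ++ Q) <= 2)%N ->
  last x w = last x anc -> contour vis x anc w.
Proof.
elim: w vis x anc Q => [|y w IH] vis x anc Q us sv Qv Qc.
  move=> _ _ /= lE; case: anc us lE {sv Qc} => // z anc /= /andP[+ _] xE.
  by rewrite {1}xE mem_last.
move=> /= /andP[tl1 tl2] c2 lE.
have xv : x \in vis by apply: sv; exact: mem_head.
have tl2' : treelike (y |: vis) [set e in epair x y :: Q] y w.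
  rewrite (_ : [set e in _ :: _] = epair x y |: [set e in Q]) //.
  by apply/setP => e; rewrite !inE.
have c2' e : (count_mem e (edges y w ++ (epair x y :: Q)) <= 2)%N.
  by apply: leq_trans (c2 e); rewrite /= !count_cat /= addnCA.
case: ifPn => yv.
  apply: (IH _ _ _ (epair x y :: Q)) => //.
  - rewrite cons_uniq us andbT; apply: contra yv; exact: sv.
  - move=> z; rewrite inE => /orP[/eqP->|/sv zv]; first exact: setU11.
    by rewrite inE zv orbT.
  - move=> e; rewrite inE => /orP[/eqP->|/Qv].
      by rewrite inside_epair !inE xv eqxx orbT.
    by rewrite /inside !inE => /andP[-> ->]; rewrite !orbT.
  - move=> e; rewrite /= (epair_sym y) !inE => /orP[->|eQ]; first by left.
    have [->|ec] := Qc _ eQ; first by left; rewrite orbT.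
    by right; apply: leq_trans ec _; exact: leq_addl.
move: tl1; rewrite (negbTE yv) orbF inE => eQ.
have eA : epair x y \in edges x anc.
  have [//|ec] := Qc _ eQ.
  have := c2 (epair x y); rewrite /= eqxx count_cat.
  rewrite leqNgt; case/negP.
  by rewrite add1n ltnS; apply: leq_trans ec _; exact: leq_addl.
case: anc us sv Qc lE eA => // z anc us sv Qc lE eA.
have zv : z \in vis by apply: sv; rewrite !inE eqxx orbT.
have yz : y = z.
  move: eA; rewrite /= inE => /orP[/eqP|eA]; first exact: epair_inj.
  have /(inside_edges (vis := [set t in z :: anc])) : epair x y \in edges z anc by [].
  rewrite inE mem_head => /(_ isT); rewrite inside_epair => H.
  have /H : {subset anc <= [set t in z :: anc]}.
    by move=> t ta; rewrite !inE ta orbT.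
  by rewrite inE; case/andP: us => /negbTE ->.
subst y; rewrite eqxx /=.
have vE : z |: vis = vis by apply/finset.setUidPr; rewrite finset.sub1set.
rewrite vE in tl2'.
apply: (IH _ _ _ (epair x z :: Q)) => //.
- by case/andP: us.
- by move=> t ta; apply: sv; rewrite inE ta orbT.
- by move=> e; rewrite inE => /orP[/eqP->|/Qv//]; rewrite inside_epair xv.
- move=> e; rewrite inE => /orP[/eqP->|eQ'].
    by right; rewrite /= eqxx -has_pred1 has_count in eQ *.
  have [|ec] := Qc _ eQ'; last by right; apply: leq_trans ec _; exact: leq_addl.
  rewrite /= inE => /orP[/eqP->|]; last by left.
  by right; rewrite /= eqxx -has_pred1 has_count in eQ *.
Qed.

(** With m steps, each edge being taken at least twice, there are at most m/2
    edges, hence at most m/2 + 1 vertices. If this bound is attained, both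
    inequalities are equalities: the graph is a tree and each edge is taken
    exactly twice. *)
Lemma closed_walk_contour x w :
  last x w = x ->
  {in edges x w, forall e, 2 <= count_mem e (edges x w)}%N ->
  (size w + 2 <= 2 * #|[set y in x :: w]|)%N ->
  contour [set x] x [::] w.
Proof.
move=> lE c2 sw.
have E0 : {in (finset.set0 : {set V * V}), forall e, inside [set x] e}.
  by move=> e; rewrite inE.
have [le tl] := vertices_le_edges w (set11 x) E0.
set S := [set e in edges x w].
have vE : [set x] :|: [set y in w] = [set y in x :: w].
  by apply/setP => z; rewrite !inE.
have eE : finset.set0 :|: S = S by rewrite finset.set0U.
rewrite -/S eE vE cards0 cards1 addn0 in le tl.
have c2S : (\sum_(e in S) 2 <= \sum_(e in S) count_mem e (edges x w)
    ?= iff [forall (e | e \in S), 2 == count_mem e (edges x w)])%N.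
  by apply: leqif_sum => e; rewrite inE => eS; split; [exact: c2|].
have sumS : (\sum_(e in S) count_mem e (edges x w) = size w)%N.
  rewrite -[RHS](size_pairmap epair x) -/(edges x w) -sum_count_mem.
  rewrite [RHS](bigID (mem S)) /= [X in (_ + X)%N]big1 ?addn0// => e.
  by rewrite inE => /count_memPn.
rewrite sumS sum_nat_const in c2S.
have [c2l c2e] := c2S.
have [kE VE] : (#|S| * 2 = size w)%N /\ #|[set y in x :: w]| = (1 + #|S|)%N.
  move: le sw c2l; move: #|[set y in x :: w]| #|S| (size w) => a b c.
  by move=> *; split; lia.
apply: (treelike_contour (Q := [::])) => //.
- by move=> z; rewrite inE => /eqP->; rewrite inE.
- have -> : [set e in [::]] = finset.set0 :> {set V * V} by apply/setP => e; rewrite !inE.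
  by rewrite -tl; apply/eqP.
- move=> e; rewrite cats0.
  have [eS|/count_memPn ->//] := boolP (e \in edges x w).
  move: c2e; rewrite kE eqxx => /esym/forallP/(_ e)/implyP.
  by rewrite inE => /(_ eS)/eqP <-.
Qed.

End walks.

(** * Counting walks *)

Section counting.
Local Close Scope classical_set_scope.
Local Open Scope nat_scope.

Lemma big_tuple0 (V : finType) (R : Type) (idx : R) (op : Monoid.com_law idx)
    (F : 0.-tuple V -> R) :
  \big[op/idx]_(t : 0.-tuple V) F t = F [tuple].
Proof.
by rewrite (big_pred1 [tuple]) // => t; apply/esym/eqP; exact: tuple0.
Qed.

Lemma big_tuple_cons (V : finType) (R : Type) (idx : R) (op : Monoid.com_law idx)
    (l : nat) (F : l.+1.-tuple V -> R) :
  \big[op/idx]_(t : l.+1.-tuple V) F t =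
  \big[op/idx]_(x : V) \big[op/idx]_(w : l.-tuple V) F (cons_tuple x w).
Proof.
rewrite (pair_big xpredT xpredT (fun x w => F (cons_tuple x w))) /=.
apply: (reindex (fun p : V * l.-tuple V => cons_tuple p.1 p.2)).
exists (fun t => (thead t, behead_tuple t)) => [[x w] _|t _] /=.
  by rewrite theadE; congr pair; apply: val_inj.
by rewrite [RHS]tuple_eta.
Qed.

(** Such a tuple is the composite of a map 'I_n.+1 -> 'I_v listing positions and
    a map 'I_v -> V listing values. *)
Lemma card_tuple_few_values (V : finType) (n v : nat) :
  #|[set t : n.+1.-tuple V | #|[set y in t]| <= v]| <= v ^ n.+1 * #|V| ^ v.
Proof.
(* The type 'I_v must be inhabited for inord. *)
case: v => [|v].
  rewrite exp0n // mul0n leqn0 cards_eq0; apply/eqP/setP => t.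
  rewrite !inE leqn0 cards_eq0; apply/negP => /eqP/setP/(_ (thead t)).
  by rewrite !inE mem_tnth.
pose F (p : {ffun 'I_n.+1 -> 'I_v.+1} * {ffun 'I_v.+1 -> V}) :=
  [tuple p.2 (p.1 i) | i < n.+1].
have sub : [set t : n.+1.-tuple V | #|[set y in t]| <= v.+1]
    \subset [set F p | p in finset.setT].
  apply/fintype.subsetP => t; rewrite inE => tv.
  pose s := enum [set y in t].
  have ss : size s <= v.+1 by rewrite -cardE.
  apply/imsetP; exists ([ffun i => inord (index (tnth t i) s)],
      [ffun j : 'I_v.+1 => nth (thead t) s j]) => //.
  apply: eq_from_tnth => i; rewrite tnth_mktuple /= !ffunE.
  have si : tnth t i \in s by rewrite mem_enum inE mem_tnth.
  rewrite inordK ?nth_index//; apply: leq_trans ss.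
  by rewrite index_mem.
apply: leq_trans (subset_leq_card sub) _.
apply: leq_trans (leq_imset_card _ _) _.
by rewrite cardsT card_prod !card_ffun !card_ord.
Qed.

(** The number of ways to complete a contour in l steps from a vertex of depth h
    when v of the N vertices have been seen. *)
Fixpoint ncontour N l h v : nat :=
  if l is l'.+1 then
    (N - v) * ncontour N l' h.+1 v.+1 + (if h is h'.+1 then ncontour N l' h' v else 0)
  else h == 0.

Lemma card_contour N l (vis : {set 'I_N}) x anc : {subset x :: anc <= vis} ->
  \sum_(w : l.-tuple 'I_N) contour vis x anc w = ncontour N l (size anc) #|vis|.
Proof.
elim: l vis x anc => [|l IH] vis x anc sv.
  by rewrite big_tuple0 /=; case: anc {sv}.
rewrite big_tuple_cons (bigID (fun y => y \notin vis)) /=; congr (_ + _).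
  transitivity (\sum_(y | y \notin vis) ncontour N l (size anc).+1 #|vis|.+1).
    apply: eq_bigr => y yv; under eq_bigr do rewrite yv.
    rewrite IH /= ?cardsU1 ?yv//.
    move=> z; rewrite inE => /orP[/eqP->|/sv zv]; first exact: setU11.
    by rewrite inE zv orbT.
  rewrite sum_nat_const; congr (_ * _).
  rewrite -[X in X - _](card_ord N) -(cardsC vis) addKn.
  by apply: eq_card => y; rewrite !inE.
case: anc sv => [|z anc] sv /=.
  by rewrite big1// => y; rewrite negbK => yv; rewrite big1// => w _; rewrite yv.
have zv : z \in vis by apply: sv; rewrite !inE eqxx orbT.
rewrite (bigD1 z) /= ?negbK//.
under eq_bigr do rewrite zv eqxx.
rewrite IH; last by move=> t ta; apply: sv; rewrite inE ta orbT.
rewrite big1 ?addn0// => y; rewrite negbK => /andP[yv /negbTE yz].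
by rewrite big1// => w _; rewrite yv yz.
Qed.

End counting.

(** * The contribution of a closed walk *)

Section weights.
Local Close Scope classical_set_scope.
Variable N : nat.
Local Notation V := 'I_N.

Lemma expmx_walk (R : comNzRingType) (f : V * V -> R) (A : 'M[R]_N) m x z :
  (forall i j, A i j = f (epair i j)) ->
  (A ^+ m) x z =
  \sum_(w : m.-tuple V) (last x w == z)%:R * \prod_(e <- edges x w) f e.
Proof.
move=> Af; elim: m x => [|m IH] x.
  by rewrite big_tuple0 /= big_nil mulr1 expr0 mxE.
rewrite exprS mxE big_tuple_cons; apply: eq_bigr => y _.
rewrite IH big_distrr /=; apply: eq_bigr => w _.
by rewrite big_cons Af mulrCA.
Qed.

Lemma prod_count (R : comNzRingType) (D : pred (V * V)) (f : V * V -> R) s :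
  all D s -> \prod_(e <- s) f e = \prod_(p | D p) f p ^+ count_mem p s.
Proof.
elim: s => [|e s IH] /=; first by rewrite big_nil big1.
move=> /andP[De Ds]; rewrite big_cons IH//.
under [RHS]eq_bigr do rewrite exprD.
rewrite big_split /=; congr (_ * _).
rewrite (bigD1 e)//= eqxx expr1 big1 ?mulr1// => p /andP[_ /negbTE].
by rewrite eq_sym => ->.
Qed.

Definition lower : pred (V * V) := fun p => (p.2 <= p.1)%N.

Lemma edges_lower x (w : seq V) : all lower (edges x w).
Proof.
elim: w x => [|y w IH] x //=; rewrite IH andbT /lower /epair /=.
by case: ifP => //= /negbT; rewrite -ltnNge => /ltnW.
Qed.

Variable R : realDomainType.
Variables (mom : nat -> R) (m : nat) (K : R).
Hypotheses (mom0 : mom 0 = 1) (mom1 : mom 1 = 0) (mom2 : mom 2 = 1).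
Hypotheses (K1 : 1 <= K) (momK : forall k, (k <= m)%N -> `|mom k| <= K ^+ k).

(** The expectation of the product of the entries along the walk, when the entries
    are independent with moments mom. *)
Definition weight x (w : seq V) : R :=
  \prod_(p | lower p) mom (count_mem p (edges x w)).

Lemma weight_le x (w : m.-tuple V) : `|weight x w| <= K ^+ m.
Proof.
rewrite /weight normr_prod.
apply: (@le_trans _ _ (\prod_(p | lower p) K ^+ count_mem p (edges x w))).
  apply: ler_prod => p _; rewrite normr_ge0 momK//.
  by apply: leq_trans (count_size _ _) _; rewrite size_pairmap size_tuple.
rewrite prodrXr ler_weXn2l//.
rewrite -[X in (_ <= X)%N](size_tuple w) -(size_pairmap (@epair N) x) -sum_count_mem.
by rewrite [leqRHS](bigID lower) leq_addr.
Qed.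

Lemma weight_contour x (w : seq V) : contour [set x] x [::] w -> weight x w = 1.
Proof.
move=> gw; have sx : {subset [:: x] <= [set x]}.
  by move=> z; rewrite !inE.
have [c1 c2] := contour_counts sx gw.
rewrite /weight big1// => p _.
have [/c1->//|/c2] := boolP (inside [set x] p).
by rewrite !inE => /orP[] /eqP ->.
Qed.

(** A walk that takes some edge exactly once has weight 0, because the first
    moment vanishes; all the others satisfy the hypothesis of
    closed_walk_contour on multiplicities. *)
Lemma weight_not_contour x (w : m.-tuple V) : last x w = x -> weight x w != 0 ->
  ~~ contour [set x] x [::] w -> (#|[set y in x :: w]| <= m.+1./2)%N.
Proof.
move=> lw w0 bw; rewrite leqNgt; apply/negP => lt; case/negP: bw.
apply: closed_walk_contour => //; last by rewrite size_tuple; lia.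
move=> e ee; rewrite ltnNge; apply/negP => c1.
have {}c1 : count_mem e (edges x w) = 1%N.
  by apply/eqP; rewrite eqn_leq c1 -has_count has_pred1.
case/negP: w0; rewrite /weight (bigD1 e) /= ?c1 ?mom1 ?mul0r//.
exact: (allP (edges_lower x w)).
Qed.

(** Contours have weight 1, and the remaining walks of nonzero weight visit at
    most (m+1)/2 vertices, so there are few of them. *)
Lemma sum_weight_ncontour :
  `|\sum_x \sum_(w : m.-tuple V) (last x w == x)%:R * weight x w
    - (N * ncontour N m 0 1)%:R| <= K ^+ m * (m.+1./2 ^ m.+1 * N ^ m.+1./2)%:R.
Proof.
have -> : (N * ncontour N m 0 1)%:R =
    \sum_(x : V) \sum_(w : m.-tuple V) (contour [set x] x [::] w)%:R :> R.
  transitivity (\sum_(x : V) (ncontour N m 0 1)%:R : R).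
    by rewrite sumr_const card_ord natrM mulr_natl.
  apply: eq_bigr => x _.
  have := @card_contour N m [set x] x [::]; rewrite cards1 => <-.
    by rewrite natr_sum.
  by move=> z; rewrite !inE.
rewrite -sumrB; under eq_bigr do rewrite -sumrB.
apply: (@le_trans _ _ (\sum_(x : V) \sum_(w : m.-tuple V)
   K ^+ m * (#|[set y in x :: w]| <= m.+1./2)%N%:R)).
  apply: le_trans (ler_norm_sum _ _ _) _; apply: ler_sum => x _.
  apply: le_trans (ler_norm_sum _ _ _) _; apply: ler_sum => w _.
  have Km0 : 0 <= K ^+ m by rewrite exprn_ge0// (le_trans ler01).
  have [gw|bw] := boolP (contour [set x] x [::] w).
    rewrite weight_contour// (contour_last gw) eqxx mulr1 subrr normr0.
    by rewrite mulr_ge0.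
  rewrite subr0; have [lw|_] := eqVneq (last x w) x; last first.
    by rewrite mul0r normr0 mulr_ge0.
  rewrite mul1r; have [->|w0] := eqVneq (weight x w) 0.
    by rewrite normr0 mulr_ge0.
  by rewrite weight_not_contour// mulr1 weight_le.
under eq_bigr do rewrite -mulr_sumr.
rewrite -mulr_sumr ler_wpM2l ?exprn_ge0 ?(le_trans ler01)//.
under eq_bigr do rewrite -natr_sum.
rewrite -natr_sum ler_nat.
have := card_tuple_few_values V m m.+1./2; rewrite card_ord; apply: leq_trans.
by rewrite -sum1dep_card [leqRHS]big_mkcond [leqRHS]big_tuple_cons.
Qed.

End weights.

(** * The limit of the expected moments *)

Section expectation.
Context d (T : measurableType d) (R : realType).
Variables (P : probability T R) (mu : probability R R).
Hypothesis mu_moments :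
  forall k : nat, mu.-integrable [set: R] (fun x => (x ^+ k)%:E).

Definition moment (k : nat) : R := \int[mu]_y y ^+ k.

Lemma expectation_ntr_wigner N (A : T -> 'M[R]_N) m : wigner P mu A ->
  ('E_P[fun w => ntr (A w ^+ m)])%E =
  (N%:R^-1 * (Num.sqrt N%:R)^-1 ^+ m *
   \sum_x \sum_(w : m.-tuple 'I_N) (last x w == x)%:R * weight moment x w)%:E.
Proof.
case=> a [AE asym aind alaw].
set c := (Num.sqrt N%:R)^-1.
pose D : seq ('I_N * 'I_N) := enum (@lower N).
have bigD F : \prod_(p <- D) F p = \prod_(p | lower p) F p :> R.
  by rewrite big_enum.
pose X (p : 'I_N * 'I_N) := a p.1 p.2.
pose mono (x : 'I_N) (t : seq 'I_N) w : R :=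
  \prod_(p <- D) X p w ^+ count_mem p (edges x t).
have H x t : P.-integrable setT (fun w => (mono x t w)%:E) /\
    (\int[P]_w (mono x t w)%:E = (weight moment x t)%:E)%E.
  rewrite /weight -bigD; apply: (@expectation_prod_indep _ _ _ P mu _
    [set p : 'I_N * 'I_N | (p.2 <= p.1)%N] X aind _ D
    (fun p y => y ^+ count_mem p (edges x t))).
  - by move=> i B mB; exact: alaw.
  - exact: enum_uniq.
  - by move=> p; rewrite mem_enum.
  - by move=> p; exact: mu_moments.
have E w : ntr (A w ^+ m) = \sum_x \sum_(t : m.-tuple 'I_N)
    (N%:R^-1 * c ^+ m * (last x t == x)%:R) * mono x t w.
  rewrite /ntr /mxtrace mulr_sumr; apply: eq_bigr => x _.
  rewrite (@expmx_walk _ _ (fun e => c * X e w)); last first.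
    move=> i j; rewrite AE !mxE /X /epair; congr (_ * _).
    by case: ifP => //= _; rewrite asym.
  rewrite mulr_sumr; apply: eq_bigr => t _.
  rewrite big_split /= big_const_seq iter_mulr_1 count_predT size_pairmap.
  rewrite size_tuple (prod_count _ (edges_lower _ _)) -bigD -/(mono x t w).
  by rewrite -!mulrA; congr (_ * _); rewrite mulrCA.
rewrite unlock; under eq_integral do rewrite E.
have I1 x (t : m.-tuple 'I_N) : P.-integrable setT (fun w =>
    ((N%:R^-1 * c ^+ m * (last x t == x)%:R) * mono x t w)%:E).
  by have := integrableZl measurableT (N%:R^-1 * c ^+ m * (last x t == x)%:R) (H x t).1.
under eq_integral => w _.
  rewrite -sumEFin; under eq_bigr do rewrite -sumEFin; over.
rewrite integral_sum//; last first.
  by move=> x; apply: integrable_sum => // t _; exact: I1.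
rewrite mulr_sumr -sumEFin; apply: eq_bigr => x _.
rewrite integral_sum// mulr_sumr -sumEFin; apply: eq_bigr => t _.
under eq_integral do rewrite EFinM.
by rewrite integralZl ?(H x t).2 ?(H x t).1// -EFinM mulrA.
Qed.

End expectation.

Section limit.
Context (R : realType).
Local Notation sqrtn N := (Num.sqrt N%:R : R).

Lemma cvg_subn_div v : (N.+1 - v)%:R / N.+1%:R @[N --> \oo] --> (1 : R).
Proof.
have : 1 - v%:R * harmonic N @[N --> \oo] --> (1 - v%:R * 0 : R).
  apply: cvgB; first exact: cvg_cst.
  by apply: cvgM; [exact: cvg_cst|exact: cvg_harmonic].
rewrite mulr0 subr0; apply: cvg_trans; apply: near_eq_cvg; near=> N.
have vN : (v <= N.+1)%N by near: N; exists v => // n /= /leqW.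
by rewrite natrB// mulrBl divff.
Unshelve. all: by end_near. Qed.

(** A contour completed in l steps from depth h discovers (l - h)/2 vertices, and
    each can be chosen in about N ways; this explains the normalization by powers
    of sqrt N, which avoids any parity distinction. With it the recurrence
    defining ncontour tends to the one satisfied by sc_moment. *)
Lemma cvg_ncontour l h v :
  (ncontour N.+1 l h v)%:R * sqrtn N.+1 ^+ h / sqrtn N.+1 ^+ l @[N --> \oo] -->
  sc_moment R l h / (2 * pi).
Proof.
have pi0 : 2 * pi != 0 :> R by rewrite mulf_neq0 ?lt0r_neq0 ?pi_gt0.
have s0 N : sqrtn N.+1 != 0 by rewrite sqrtr_eq0 -ltNge ltr0Sn.
elim: l h v => [|l IH] h v.
  rewrite sc_moment0 /=; case: h => [|h] /=.
    by rewrite divff//; under eq_fun do rewrite !expr0 divr1 mulr1; exact: cvg_cst.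
  by rewrite mul0r; under eq_fun do rewrite !mul0r; exact: cvg_cst.
pose B N : R := if h is h'.+1 then
  (ncontour N.+1 l h' v)%:R * sqrtn N.+1 ^+ h' / sqrtn N.+1 ^+ l else 0.
have cB : B N @[N --> \oo] -->
    (if h is h'.+1 then sc_moment R l h' else 0) / (2 * pi).
  rewrite /B; case: h {B} => [|h]; last exact: IH.
  by rewrite mul0r; exact: cvg_cst.
have -> : (fun N => (ncontour N.+1 l.+1 h v)%:R * sqrtn N.+1 ^+ h / sqrtn N.+1 ^+ l.+1)
  = (fun N => (N.+1 - v)%:R / N.+1%:R * ((ncontour N.+1 l h.+1 v.+1)%:R
      * sqrtn N.+1 ^+ h.+1 / sqrtn N.+1 ^+ l) + B N).
  apply/funext => N; rewrite [ncontour _ l.+1 _ _]/= natrD natrM.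
  have sN : N.+1%:R = sqrtn N.+1 * sqrtn N.+1 by rewrite -expr2 sqr_sqrtr.
  rewrite [in X in _ / X]sN /B; move: (sqrtn N.+1) (s0 N) => s sn0.
  have sl : s ^+ l != 0 by rewrite expf_neq0.
  case: h {B cB} => [|h]; rewrite ?addr0 !exprS; field; exact/andP.
rewrite sc_momentS mulrDl; apply: cvgD => //.
rewrite -[X in _ --> X]mul1r; apply: cvgM; [exact: cvg_subn_div|exact: IH].
Qed.

(** The closed walks of nonzero weight that are not contours number
    O(N ^ ((m+1)/2)), against a
    normalization by N ^ (1 + m/2), so their contribution is O(N ^ (-1/2)). *)
Lemma cvg_closed_walks m (mom : nat -> R) :
  mom 0 = 1 -> mom 1 = 0 -> mom 2 = 1 ->
  N.+1%:R^-1 * (sqrtn N.+1)^-1 ^+ m *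
    (\sum_x \sum_(w : m.-tuple 'I_N.+1) (last x w == x)%:R * weight mom x w)
  @[N --> \oo] --> sc_moment R m 0 / (2 * pi).
Proof.
move=> mom0 mom1 mom2.
(* Any K at least 1 and at least all |mom k| works, since K <= K ^ k for k > 0. *)
pose K : R := 1 + \sum_(k < m.+1) `|mom k|.
have K1 : 1 <= K by rewrite lerDl sumr_ge0.
have momK k : (k <= m)%N -> `|mom k| <= K ^+ k.
  case: k => [_|k km]; first by rewrite mom0 normr1 expr0.
  apply: (@le_trans _ _ K); last by rewrite -[leLHS]expr1 ler_weXn2l.
  rewrite /K (bigD1 (Ordinal (km : (k.+1 < m.+1)%N)))//= addrCA lerDl.
  by rewrite addr_ge0 ?sumr_ge0.
set v := m.+1./2.
pose S N : R := \sum_x \sum_(w : m.-tuple 'I_N.+1)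
  (last x w == x)%:R * weight mom x w.
pose G N : R := (ncontour N.+1 m 0 1)%:R * sqrtn N.+1 ^+ 0 / sqrtn N.+1 ^+ m.
pose u N : R := N.+1%:R^-1 * (sqrtn N.+1)^-1 ^+ m * S N.
pose C : R := K ^+ m * (v ^ m.+1)%:R.
have C0 : 0 <= C by rewrite mulr_ge0// exprn_ge0// (le_trans ler01).
have uG N : `|u N - G N| <= C * Num.sqrt (harmonic N).
  have s0 : 0 < sqrtn N.+1 by rewrite sqrtr_gt0 ltr0Sn.
  have s1 : 1 <= sqrtn N.+1 by rewrite -[leLHS]sqrtr1 ler_wsqrtr// ler1n.
  have sN : N.+1%:R = sqrtn N.+1 ^+ 2 by rewrite sqr_sqrtr.
  have -> : u N - G N = N.+1%:R^-1 * (sqrtn N.+1)^-1 ^+ m *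
      (S N - (N.+1 * ncontour N.+1 m 0 1)%:R).
    rewrite mulrBr; congr (_ - _); rewrite /G expr0 mulr1 natrM exprVn.
    by rewrite [RHS]mulrACA mulVf ?pnatr_eq0// mul1r mulrC.
  rewrite normrM ger0_norm; last by rewrite mulr_ge0 ?exprn_ge0 ?invr_ge0 ?ltW.
  have := @sum_weight_ncontour N.+1 R mom m K mom0 mom1 mom2 K1 momK.
  rewrite -/v -/(S N) (natrM _ (v ^ _)) mulrA -/C => H.
  have -> : Num.sqrt (harmonic N) = (sqrtn N.+1)^-1 by rewrite /harmonic /= sqrtrV.
  apply: le_trans (ler_wpM2l _ H) _.
    by rewrite mulr_ge0 ?exprn_ge0 ?invr_ge0 ?ltW.
  rewrite mulrCA ler_wpM2l// natrX [in X in X ^-1]sN [in X in X ^+ v]sN.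
  move: (sqrtn N.+1) s0 s1 => s s0 s1.
  rewrite -exprM exprVn -invfM mulrC ler_pdivrMr ?mulr_gt0 ?exprn_gt0//.
  rewrite -exprD.
  have -> : s^-1 * s ^+ (2 + m) = s ^+ m.+1.
    by rewrite add2n [in LHS]exprS mulKf// gt_eqF.
  rewrite ler_weXn2l// mul2n /v.
  by rewrite -[leqRHS]odd_double_half leq_addl.
have -> : sc_moment R m 0 / (2 * pi) = sc_moment R m 0 / (2 * pi) + 0.
  by rewrite addr0.
suff : G N + (u N - G N) @[N --> \oo] --> sc_moment R m 0 / (2 * pi) + 0.
  by under eq_fun do rewrite addrC subrK.
apply: cvgD; first exact: cvg_ncontour.
have Ch : C * Num.sqrt (harmonic N) @[N --> \oo] --> 0.
  rewrite -[X in _ --> X](mulr0 C) -(@sqrtr0 R).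
  apply: cvgM; first exact: cvg_cst.
  apply: continuous_cvg; [exact: sqrt_continuous|exact: cvg_harmonic].
apply: (@squeeze_cvgr _ _ _ _ (fun N => - (C * Num.sqrt (harmonic N)))
  (fun N => C * Num.sqrt (harmonic N))) => //.
  by apply: nearW => N; rewrite -ler_norml.
by rewrite -oppr0; apply: cvgN.
Qed.

End limit.

Theorem theorem3p9 (R : realType) (mu : probability R R)
    (mu_moments : forall k : nat, mu.-integrable [set: R] (fun x => (x ^+ k)%:E))
    (mu_mean : (\int[mu]_x x%:E)%E = 0%E)
    (mu_second : (\int[mu]_x (x ^+ 2)%:E)%E = 1%E)
    (d : nat -> measure_display) (T : forall N : nat, measurableType (d N))
    (P : forall N : nat, probability (T N) R)
    (A : forall N : nat, T N -> 'M[R]_N)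
    (A_wigner : forall N : nat, (0 < N)%N -> wigner (P N) mu (@A N))
    (m : nat) :
  ('E_(P N)[fun w => ntr (A N w ^+ m)])%E @[N --> \oo] -->
  ((2 * pi)^-1 *
   \int[lebesgue_measure]_(x in `[-2, 2]) (x ^+ m * Num.sqrt (4 - x ^+ 2)))%:E.
Proof.
rewrite integral_semicircle mulrC -cvg_shiftS.
under eq_fun do rewrite (expectation_ntr_wigner mu_moments _ (A_wigner _.+1 isT)).
apply: cvg_EFin; first exact: nearW.
apply: cvg_closed_walks.
- rewrite /moment; under eq_Rintegral do rewrite expr0.
  rewrite Rintegral_cst// mul1r; exact: (congr1 fine (probability_setT mu)).
- by rewrite /moment /Rintegral; under eq_integral do rewrite expr1; rewrite mu_mean.
- by rewrite /moment /Rintegral mu_second.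
Qed.
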